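(* Let $(\mu_t=\sum_{i=0}^Nt^i\mu_i,\ \phi_t=\sum_{i=0}^Nt^i\phi_i)$ be a deformation of order $N$ of a LeibDer pair $(\mathfrak{g},\phi_\mathfrak{g})$. Then the pair $(\mathrm{Ob}^3,\mathrm{Ob}^2)\in C^3_{\mathrm{LeibDer}}(\mathfrak{g},\mathfrak{g})$, where $$\mathrm{Ob}^3=\frac12\sum_{i+j=N+1,\ i,j>0}\llbracket\mu_i,\mu_j\rrbracket,\qquad \mathrm{Ob}^2=\sum_{i+j=N+1,\ i,j>0}\llbracket\phi_i,\mu_j\rrbracket,$$ is a 3-cocycle in the cohomology of the LeibDer pair $(\mathfrak{g},\phi_\mathfrak{g})$ with coefficients in itself.
   Context: All vector spaces and linear maps are over a field $\mathbb{K}$ of characteristic zero. A (right) Leibniz algebra is a vector space $\mathfrak{g}$ with a bilinear bracket satisfying $[[x,y],z]=[[x,z],y]+[x,[y,z]]$. A LeibDer pair $(\mathfrak{g},\phi_\mathfrak{g})$ is a Leibniz algebra with a derivation $\phi_\mathfrak{g}$ ($\phi_\mathfrak{g}[x,y]=[\phi_\mathfrak{g}(x),y]+[x,\phi_\mathfrak{g}(y)]$). Write $\mu(x,y)=[x,y]$. Cohomology with coefficients in itself: for $f\in\mathrm{Hom}(\mathfrak{g}^{\otimes n},\mathfrak{g})$, $$(\delta_Lf)(x_1,\ldots,x_{n+1})=[x_1,f(x_2,\ldots,x_{n+1})]+\sum_{i=2}^{n+1}(-1)^i[f(x_1,\ldots,\widehat{x_i},\ldots,x_{n+1}),x_i]+\sum_{i<j}(-1)^{j+1}f(x_1,\ldots,x_{i-1},[x_i,x_j],x_{i+1},\ldots,\widehat{x_j},\ldots,x_{n+1}),$$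 $$\delta f=\sum_{i=1}^nf\circ(\mathrm{id}\otimes\cdots\otimes\phi_\mathfrak{g}\otimes\cdots\otimes\mathrm{id})-\phi_\mathfrak{g}\circ f\quad(\phi_\mathfrak{g}\text{ in the }i\text{-th place}).$$ For $n\ge2$, $C^n_{\mathrm{LeibDer}}(\mathfrak{g},\mathfrak{g})=\mathrm{Hom}(\mathfrak{g}^{\otimes n},\mathfrak{g})\times\mathrm{Hom}(\mathfrak{g}^{\otimes n-1},\mathfrak{g})$ with $\partial(f_n,\overline f_n)=(\delta_Lf_n,\delta_L\overline f_n+(-1)^n\delta f_n)$; a cocycle is an element killed by $\partial$. A deformation of order $N$ of $(\mathfrak{g},\phi_\mathfrak{g})$ consists of finite sums $\mu_t=\sum_{i=0}^Nt^i\mu_i$ ($\mu_i\in\mathrm{Hom}(\mathfrak{g}^{\otimes2},\mathfrak{g})$, $\mu_0=\mu$) and $\phi_t=\sum_{i=0}^Nt^i\phi_i$ ($\phi_i\in\mathrm{Hom}(\mathfrak{g},\mathfrak{g})$, $\phi_0=\phi_\mathfrak{g}$) such that $\mu_t$ defines a Leibniz bracket on $\mathfrak{g}[[t]]/(t^{N+1})$ and $\phi_t$ is a derivation on it. The brackets used are: for $\alpha,\beta\in\mathrm{Hom}(\mathfrak{g}^{\otimes2},\mathfrak{g})$ and $\varphi\in\mathrm{Hom}(\mathfrak{g},\mathfrak{g})$, $\llbracket\alpha,\beta\rrbracket=\alpha\bullet\beta+\beta\bullet\alpha$ with $(\alpha\bullet\beta)(x,y,z)=\alpha(\beta(x,y),z)-\alpha(\beta(x,z),y)-\alpha(x,\beta(y,z))$,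 and $\llbracket\varphi,\alpha\rrbracket(x,y)=\varphi(\alpha(x,y))-\alpha(\varphi(x),y)-\alpha(x,\varphi(y))$. *)

(* Defs.v *)
From HB Require Import structures.
From mathcomp Require Import all_boot all_order all_algebra.
From mathcomp Require Import sesquilinear.

Set Implicit Arguments.
Unset Strict Implicit.
Unset Printing Implicit Defensive.

Import GRing.Theory.
Local Open Scope ring_scope.

(* Right Leibniz algebras and their derivations. Bilinearity of the bracket   *)
(* and linearity of the derivation are carried by the types                   *)
(* {bilinear V -> V -> V} and {linear V -> V} of the maps used below.         *)
Definition leibniz_identity (V : zmodType) (b : V -> V -> V) : Prop :=
  forall x y z, b (b x y) z = b (b x z) y + b x (b y z).

Definition derivation_of (V : zmodType) (b : V -> V -> V) (d : V -> V) : Prop :=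
  forall x y, d (b x y) = b (d x) y + b x (d y).

Definition leibDer_pair (K : fieldType) (g : lmodType K)
    (mu : {bilinear g -> g -> g}) (phi : {linear g -> g}) : Prop :=
  leibniz_identity mu /\ derivation_of mu phi.

Section Cohomology.

Variables (K : fieldType) (g : lmodType K).

(* An element of Hom(g^{(x) n}, g) is a function of n arguments, packed as a  *)
(* finite family, that satisfies the predicate multilinear.                   *)
Definition nary (n : nat) := {ffun 'I_n -> g} -> g.

Definition set_arg n (x : {ffun 'I_n -> g}) (i : 'I_n) (v : g) :
    {ffun 'I_n -> g} :=
  [ffun k => if k == i then v else x k].

Definition multilinear n (f : nary n) : Prop :=
  forall (x : {ffun 'I_n -> g}) (i : 'I_n), linear (fun v => f (set_arg x i v)).

Definition omit_arg n (x : {ffun 'I_n.+1 -> g}) (j : 'I_n.+1) :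
    {ffun 'I_n -> g} :=
  [ffun k => x (lift j k)].

Variables (mu : {bilinear g -> g -> g}) (phi : {linear g -> g}).

(* Arguments are numbered from 0: x i is the argument x_{i+1} of the usual    *)
(* formula, whence the exponents i.+1 and j.+2 in place of i and j + 1.       *)
Definition deltaL n (f : nary n) : nary n.+1 := fun x =>
  mu (x ord0) (f (omit_arg x ord0))
  + \sum_(i < n.+1 | (0 < i)%N) (-1) ^+ i.+1 *: mu (f (omit_arg x i)) (x i)
  + \sum_(i < n.+1) \sum_(j < n.+1 | (i < j)%N)
      (-1) ^+ j.+2 *: f (omit_arg (set_arg x i (mu (x i) (x j))) j).

Definition delta n (f : nary n) : nary n := fun x =>
  \sum_(i < n) f (set_arg x i (phi (x i))) - phi (f x).

(* Cochains of degree n.+1, for n > 0. *)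
Definition in_LeibDer_cochains n (F : nary n.+1 * nary n) : Prop :=
  multilinear F.1 /\ multilinear F.2.

Definition LeibDer_diff n (F : nary n.+1 * nary n) : nary n.+2 * nary n.+1 :=
  (deltaL F.1, fun x => deltaL F.2 x + (-1) ^+ n.+1 *: delta F.1 x).

Definition LeibDer_cocycle n (F : nary n.+1 * nary n) : Prop :=
  [/\ in_LeibDer_cochains F,
      forall x, (LeibDer_diff F).1 x = 0 &
      forall x, (LeibDer_diff F).2 x = 0].

End Cohomology.

Section Deformation.

Variables (K : fieldType) (g : lmodType K) (N : nat).

(* g[[t]]/(t^{N+1}): the family x stands for \sum_(k <= N) t^k x_k. *)
Definition tseries := {ffun 'I_N.+1 -> g}.

HB.instance Definition _ := GRing.Lmodule.on tseries.

Variables (mu : {bilinear g -> g -> g}) (phi : {linear g -> g}).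
Variables (mu_ : 'I_N.+1 -> {bilinear g -> g -> g}).
Variables (phi_ : 'I_N.+1 -> {linear g -> g}).

(* The K[[t]]/(t^{N+1})-(bi)linear extensions of \sum_i t^i mu_i and          *)
(* \sum_i t^i phi_i to g[[t]]/(t^{N+1}).                                      *)
Definition mu_t (x y : tseries) : tseries :=
  [ffun n : 'I_N.+1 => \sum_(i < N.+1) \sum_(j < N.+1)
    \sum_(k < N.+1 | (i + j + k == n)%N) mu_ i (x j) (y k)].

Definition phi_t (x : tseries) : tseries :=
  [ffun n : 'I_N.+1 => \sum_(i < N.+1) \sum_(j < N.+1 | (i + j == n)%N)
    phi_ i (x j)].

Fact mu_t_is_bilinear : bilinear_for
  (GRing.Scale.Law.clone _ _ *:%R _) (GRing.Scale.Law.clone _ _ *:%R _) mu_t.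
Proof.
split=> [u|u] a x y; apply/ffunP=> n; rewrite !ffunE scaler_sumr -big_split;
  apply: eq_bigr => i _; rewrite scaler_sumr -big_split;
  apply: eq_bigr => j _; rewrite scaler_sumr -big_split;
  apply: eq_bigr => k _; rewrite !ffunE.
- by rewrite linearPl.
- by rewrite linearPr.
Qed.

HB.instance Definition _ :=
  bilinear_isBilinear.Build K tseries tseries tseries _ _ mu_t mu_t_is_bilinear.

Fact phi_t_is_linear : linear phi_t.
Proof.
move=> a x y; apply/ffunP=> n; rewrite !ffunE scaler_sumr -big_split.
apply: eq_bigr => i _; rewrite scaler_sumr -big_split.
by apply: eq_bigr => j _; rewrite !ffunE linearP.
Qed.

HB.instance Definition _ :=
  GRing.isLinear.Build K tseries tseries _ phi_t phi_t_is_linear.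

Definition deformation : Prop :=
  [/\ forall x y, mu_ ord0 x y = mu x y, forall x, phi_ ord0 x = phi x,
      leibniz_identity mu_t & derivation_of mu_t phi_t].

Definition bullet (a b : g -> g -> g) (x y z : g) : g :=
  a (b x y) z - a (b x z) y - a x (b y z).

Definition bracket_mu_mu (a b : g -> g -> g) (x y z : g) : g :=
  bullet a b x y z + bullet b a x y z.

Definition bracket_phi_mu (f : g -> g) (a : g -> g -> g) (x y : g) : g :=
  f (a x y) - a (f x) y - a x (f y).

Definition Ob3 : nary g 3 := fun x =>
  2%:R^-1 *: \sum_(i < N.+1)
    \sum_(j < N.+1 | [&& (i + j == N.+1)%N, (0 < i)%N & (0 < j)%N])
      bracket_mu_mu (mu_ i) (mu_ j) (x 0) (x 1) (x 2%:R).

Definition Ob2 : nary g 2 := fun x =>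
  \sum_(i < N.+1)
    \sum_(j < N.+1 | [&& (i + j == N.+1)%N, (0 < i)%N & (0 < j)%N])
      bracket_phi_mu (phi_ i) (mu_ j) (x 0) (x 1).

End Deformation.

(* Main.v *)
Require Import Defs.
From HB Require Import structures.
From mathcomp Require Import all_boot all_order all_algebra.
From mathcomp Require Import sesquilinear.

Set Implicit Arguments.
Unset Strict Implicit.
Unset Printing Implicit Defensive.

Import GRing.Theory.
Local Open Scope ring_scope.

(** Extend the families mu_i and phi_i by zero to order N + 1. The resulting
    bracket [b] and map [d] on g[t]/(t^(N+2)) need no longer satisfy the Leibniz
    and derivation rules; their failure is measured by

      J(x, y, z) = b(b(x, y), z) - b(b(x, z), y) - b(x, b(y, z)),
      E(x, y)    = d(b(x, y)) - b(d(x), y) - b(x, d(y)).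

    Modulo t^(N+1) both vanish, because the original families form a deformation
    of order N. Hence J and E take values in t^(N+1) g, and, being linear over
    K[t], they depend only on the constant terms of their arguments
    ([jacobiator_top_term], [defect_top_term]). On constants, the coefficient of
    t^(N+1) in J is Ob^3, the factor 1/2 undoing the symmetrisation of the double
    bracket, and the one in E is Ob^2 ([Ob3E], [Ob2E]): the products with mu_0
    or phi_0 drop out since the extended families vanish in degree N + 1.

    The cocycle equations come from two identities that hold for an arbitrary
    bilinear bracket b and linear map d: the coboundary formula with respect to b
    kills J ([jacobiator_bianchi]), and the failure of d to commute with J is the
    insertion of E into b and of b into E ([jacobiator_defect]). In these, every
    term contains J or E, which is already of degree N + 1 in t, so taking the
    coefficient of t^(N+1) replaces each remaining b and d by mu_0 and phi_0.
    What is left is the vanishing of the two components of the differential of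
    (Ob^3, Ob^2). *)

(** * Identities for an arbitrary bracket *)

(** Proves that a signed sum in an abelian group is zero when its terms cancel in
    pairs. The added leading 0 makes every term the right operand of an addition,
    so that it can be carried to the end of the sum. *)
Ltac zmod_cancel :=
  rewrite ?(opprD, opprK, addrA);
  (* Variables in place of the terms keep the rewriting below fast. *)
  repeat match goal with |- context [@GRing.opp _ ?t] =>
    tryif is_var t then fail else generalize t => ? end;
  match goal with |- ?x = _ => rewrite -[x]add0r !addrA end;
  repeat match goal with |- context [@GRing.opp _ ?t] =>
    rewrite ?[_ + - t + _]addrAC ?[_ + t + _]addrAC subrK; clear t
  end.

Section Identities.

Variables (K : fieldType) (V : lmodType K).
Variables (b : {bilinear V -> V -> V}) (d : {linear V -> V}).

Local Notation J := (bullet b b).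
Local Notation E := (bracket_phi_mu d b).

(** Since J is half of the double bracket of b with itself, this is, up to sign,
    the graded Jacobi identity for three copies of b, written as the coboundary
    formula for J with b in place of a Leibniz bracket. *)
Lemma jacobiator_bianchi x y z w :
  b x (J y z w) + b (J x z w) y - b (J x y w) z + b (J x y z) w
  - J (b x y) z w + J (b x z) y w - J (b x w) y z
  + J x (b y z) w - J x (b y w) z - J x y (b z w) = 0.
Proof.
rewrite /bullet.
have := linearBl b; have := linearBr b.
move: (b : V -> V -> V) => c br bl; rewrite !(bl, br).
by zmod_cancel.
Qed.

(** The bracket with d is a derivation of the insertion product: since
    J is the insertion of b into itself, [[d, J]] is obtained by replacing each
    of the two copies of b by E = [[d, b]] in turn. *)
Lemma jacobiator_defect x y z :
  d (J x y z) - J (d x) y z - J x (d y) z - J x y (d z)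
  - bullet E b x y z - bullet b E x y z = 0.
Proof.
rewrite /bullet /bracket_phi_mu.
have := linearBl b; have := linearBr b; have := linearB d.
move: (b : V -> V -> V) (d : V -> V) => c e dB br bl.
rewrite !(bl, br, dB).
by zmod_cancel.
Qed.

Lemma bullet_linear1 y z : linear (fun x => J x y z).
Proof.
by move=> a u v; rewrite /bullet !linearPl !scalerBr !opprD;
  rewrite (AC (2*2*2) ((1*3*5)*(2*4*6))).
Qed.

Lemma bullet_linear2 x z : linear (fun y => J x y z).
Proof.
by move=> a u v; rewrite /bullet !(linearPl, linearPr) !scalerBr !opprD;
  rewrite (AC (2*2*2) ((1*3*5)*(2*4*6))).
Qed.

Lemma bullet_linear3 x y : linear (J x y).
Proof.
by move=> a u v; rewrite /bullet !(linearPl, linearPr) !scalerBr !opprD;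
  rewrite (AC (2*2*2) ((1*3*5)*(2*4*6))).
Qed.

Lemma bracket_phi_mu_linear1 y : linear (fun x => E x y).
Proof.
move=> a u v; rewrite /bracket_phi_mu !(linearP d, linearPl).
by rewrite !scalerBr !opprD (AC (2*2*2) ((1*3*5)*(2*4*6))).
Qed.

Lemma bracket_phi_mu_linear2 x : linear (E x).
Proof.
move=> a u v; rewrite /bracket_phi_mu !(linearP d, linearPr).
by rewrite !scalerBr !opprD (AC (2*2*2) ((1*3*5)*(2*4*6))).
Qed.

End Identities.

(** * Cochains of degree at most three *)

Section LowDegree.

Variables (K : fieldType) (g : lmodType K).
Variables (mu : {bilinear g -> g -> g}) (phi : {linear g -> g}).

(** In the expansions below, the arguments are listed explicitly so that omitting
    and replacing arguments reduce by computation. *)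
Lemma deltaL_binary (f : nary g 2) (F : g -> g -> g) (a b c : g) :
  (forall y, f y = F (y 0) (y 1)) ->
  deltaL mu f [ffun k : 'I_3 => nth 0 [:: a; b; c] k] =
    mu a (F b c) + mu (F a c) b - mu (F a b) c
    - F (mu a b) c + F (mu a c) b + F a (mu b c).
Proof.
(* The signs and argument positions come out in terms of bump. *)
have bump0 k : bump 0 k = k.+1 by [].
move=> fF; rewrite /deltaL.
rewrite big_mkcond !big_ord_recl big_ord0 /=.
do ![rewrite [\sum_(j < _ | _ ) _]big_mkcond !big_ord_recl big_ord0 /=].
rewrite [\sum_(i < 0) _]big_ord0.
rewrite !fF !ffunE /= !bump0 !addr0 !add0r.
rewrite -!(signr_odd _ _.+1) /= !expr0 !expr1 !scaleN1r !scale1r !addrA.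
by [].
Qed.

Lemma deltaL_ternary (f : nary g 3) (F : g -> g -> g -> g) (a b c d : g) :
  (forall y, f y = F (y 0) (y 1) (y 2%:R)) ->
  deltaL mu f [ffun k : 'I_4 => nth 0 [:: a; b; c; d] k] =
  mu a (F b c d) + mu (F a c d) b - mu (F a b d) c + mu (F a b c) d
  - F (mu a b) c d + F (mu a c) b d - F (mu a d) b c
  + F a (mu b c) d - F a (mu b d) c - F a b (mu c d).
Proof.
have bump0 k : bump 0 k = k.+1 by [].
move=> fF; rewrite /deltaL.
rewrite big_mkcond !big_ord_recl big_ord0 /=.
do ![rewrite [\sum_(j < _ | _ ) _]big_mkcond !big_ord_recl big_ord0 /=].
rewrite [\sum_(i < 0) _]big_ord0.
rewrite !fF !ffunE /= !bump0 !addr0 !add0r.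
rewrite -!(signr_odd _ _.+1) /= !expr0 !expr1 !scaleN1r !scale1r !addrA.
by [].
Qed.

Lemma delta_ternary (f : nary g 3) (F : g -> g -> g -> g) (a b c : g) :
  (forall y, f y = F (y 0) (y 1) (y 2%:R)) ->
  delta phi f [ffun k : 'I_3 => nth 0 [:: a; b; c] k] =
    F (phi a) b c + F a (phi b) c + F a b (phi c) - phi (F a b c).
Proof.
move=> fF; rewrite /delta !big_ord_recl big_ord0 !fF !ffunE /=.
by rewrite addr0 !addrA.
Qed.

Lemma multilinear_binary (f : nary g 2) (F : g -> g -> g) :
  (forall y, f y = F (y 0) (y 1)) ->
  (forall y, linear (fun x => F x y)) -> (forall x, linear (F x)) ->
  multilinear f.
Proof.
move=> fF F1 F2 x i a u v; rewrite !fF !ffunE /=.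
by case: i => [[|[|i]] ?] //=; rewrite ?F1 ?F2.
Qed.

Lemma multilinear_ternary (f : nary g 3) (F : g -> g -> g -> g) :
  (forall y, f y = F (y 0) (y 1) (y 2%:R)) ->
  (forall y z, linear (fun x => F x y z)) ->
  (forall x z, linear (fun y => F x y z)) ->
  (forall x y, linear (F x y)) ->
  multilinear f.
Proof.
move=> fF F1 F2 F3 x i a u v; rewrite !fF !ffunE /=.
by case: i => [[|[|[|i]]] ?] //=; rewrite ?F1 ?F2 ?F3.
Qed.

End LowDegree.

Lemma ffun_nth3 (T : zmodType) (x : {ffun 'I_3 -> T}) :
  x = [ffun k : 'I_3 => nth 0 [:: x 0; x 1; x 2%:R] k].
Proof.
apply/ffunP=> -[[|[|[|k]]] lt_k3] //; rewrite ffunE /=; congr (x _);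
  exact: val_inj.
Qed.

Lemma ffun_nth4 (T : zmodType) (x : {ffun 'I_4 -> T}) :
  x = [ffun k : 'I_4 => nth 0 [:: x 0; x 1; x 2%:R; x 3%:R] k].
Proof.
apply/ffunP=> -[[|[|[|[|k]]]] lt_k4] //; rewrite ffunE /=; congr (x _);
  exact: val_inj.
Qed.

(** * Truncated power series of one more order *)

Section OrdinalSums.

Variable V : zmodType.

Lemma sum_ord_drop m (h : 'I_m.+1) (P : pred 'I_m.+1) (F : 'I_m.+1 -> V) :
  (P h -> F h = 0) ->
  \sum_(i | P i) F i = \sum_(i | P (lift h i)) F (lift h i).
Proof.
move=> Fh0; rewrite big_mkcond (bigD1_ord h) //= -big_mkcond.
by case: ifP => [/Fh0->|_]; rewrite add0r.
Qed.

Lemma sum_ord_single m (h : 'I_m) (P : pred 'I_m) (F : 'I_m -> V) :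
  (forall i, i != h -> P i -> F i = 0) ->
  \sum_(i | P i) F i = if P h then F h else 0.
Proof.
move=> F0; rewrite big_mkcond (bigD1 h) //= big1 ?addr0 // => i ih.
by case: ifP => // /F0->.
Qed.

End OrdinalSums.

Section OneMoreOrder.

Variables (K : fieldType) (g : lmodType K) (N : nat).

Local Notation S := (tseries g N.+1).

Definition trunc (x : S) : tseries g N :=
  [ffun k => x (lift ord_max k)].

Definition tail (x : S) : tseries g N :=
  [ffun k => x (lift ord0 k)].

(** Multiplication by t, which is well defined from g[t]/(t^(N+1)) to
    g[t]/(t^(N+2)). *)
Definition shift (y : tseries g N) : S :=
  [ffun n => if unlift ord0 n is Some k then y k else 0].

Definition const_term (v : g) : S :=
  [ffun n => if n == ord0 then v else 0].

Definition top_term (v : g) : S :=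
  [ffun n => if n == ord_max then v else 0].

Lemma truncB : {morph trunc : x y / x - y}.
Proof. by move=> x y; apply/ffunP=> k; rewrite !ffunE. Qed.

Lemma shiftB : {morph shift : x y / x - y}.
Proof.
by move=> x y; apply/ffunP=> k; rewrite !ffunE; case: unliftP => *;
   rewrite ?ffunE ?subr0.
Qed.

Lemma shift0 : shift 0 = 0.
Proof. by rewrite -[0 in LHS](subrr 0) shiftB subrr. Qed.

Lemma shift_lift y k : shift y (lift ord0 k) = y k.
Proof. by rewrite ffunE liftK. Qed.

Lemma shift_ord0 y : shift y ord0 = 0.
Proof. by rewrite ffunE unlift_none. Qed.

Lemma const_term_shift (x : S) : x = const_term (x ord0) + shift (tail x).
Proof.
apply/ffunP=> n; rewrite !ffunE; case: unliftP => [k ->|->].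
  by rewrite add0r ffunE.
by rewrite eqxx addr0.
Qed.

Lemma trunc0_top_term (x : S) : trunc x = 0 -> x = top_term (x ord_max).
Proof.
move=> /ffunP x0; apply/ffunP=> n; rewrite !ffunE.
case: (unliftP ord_max n) => [k ->|->]; last by rewrite eqxx.
by have := x0 k; rewrite !ffunE => ->; rewrite eq_sym (negbTE (neq_lift _ _)).
Qed.

Lemma top_term_max v : top_term v ord_max = v.
Proof. by rewrite ffunE eqxx. Qed.

Lemma trunc_top_term v : trunc (top_term v) = 0.
Proof. by apply/ffunP=> k; rewrite !ffunE eq_sym (negbTE (neq_lift _ _)). Qed.

(** By [const_term_shift], every series is its constant term plus a multiple
    of t. *)
Lemma additive_const_term (V : zmodType) (F : S -> V) (x : S) :
  {morph F : y z / y + z} -> (forall y, F (shift y) = 0) ->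
  F x = F (const_term (x ord0)).
Proof. by move=> FD F0; rewrite [in LHS](const_term_shift x) FD F0 addr0. Qed.

Section Bilinear.

Variable nu_ : 'I_N.+2 -> {bilinear g -> g -> g}.

Lemma mu_t_ord0 (x y : S) : mu_t nu_ x y ord0 = nu_ ord0 (x ord0) (y ord0).
Proof.
rewrite ffunE (sum_ord_single (h := ord0)) => [|i i0 _] /=; last first.
  rewrite big1 // => j _; rewrite big_pred0 // => k.
  by rewrite -addnA addn_eq0; case: i i0 => [[|i] ?].
rewrite (sum_ord_single (h := ord0)) => [|i i0 _] /=; last first.
  rewrite big_pred0 // => k.
  by rewrite addn_eq0; case: i i0 => [[|i] ?].
by rewrite (sum_ord_single (h := ord0)) // => -[[|i] ?].
Qed.

Lemma mu_t_const_termr (x : S) v n :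
  mu_t nu_ x (const_term v) n =
  \sum_(i < N.+2) \sum_(j < N.+2 | (i + j == n)%N) nu_ i (x j) v.
Proof.
rewrite ffunE; apply: eq_bigr => i _; rewrite [RHS]big_mkcond.
apply: eq_bigr => j _; rewrite (sum_ord_single (h := ord0)) => [|k k0 _].
  by rewrite addn0 ffunE eqxx.
by rewrite ffunE (negbTE k0) linear0r.
Qed.

Lemma mu_t_const_terml (x : S) v n :
  mu_t nu_ (const_term v) x n =
  \sum_(i < N.+2) \sum_(j < N.+2 | (i + j == n)%N) nu_ i v (x j).
Proof.
rewrite ffunE; apply: eq_bigr => i _; rewrite (sum_ord_single (h := ord0)) //=.
  by rewrite addn0; apply: eq_bigr => j _; rewrite ffunE eqxx.
by move=> j j0 _; apply: big1 => k _; rewrite ffunE (negbTE j0) linear0l.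
Qed.

Lemma mu_t_const_term u v n :
  mu_t nu_ (const_term u) (const_term v) n = nu_ n u v.
Proof.
rewrite mu_t_const_termr (sum_ord_single (h := n)) /= => [|i inn _].
  rewrite (sum_ord_single (h := ord0)) /= => [|j j0 _].
    by rewrite addn0 eqxx ffunE.
  by rewrite ffunE (negbTE j0) linear0l.
rewrite (sum_ord_single (h := ord0)) /= => [|j j0 _].
  by rewrite addn0 val_eqE (negbTE inn).
by rewrite ffunE (negbTE j0) linear0l.
Qed.

Variable mu_ : 'I_N.+1 -> {bilinear g -> g -> g}.
Hypothesis nu_mu : forall i x y, nu_ (lift ord_max i) x y = mu_ i x y.

Lemma trunc_mu_t x y : trunc (mu_t nu_ x y) = mu_t mu_ (trunc x) (trunc y).
Proof.
apply/ffunP=> n; have nN := ltn_ord n; rewrite !ffunE lift_max.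
rewrite (sum_ord_drop (h := ord_max)) => [|_]; last first.
  rewrite big1 // => j _; rewrite big_pred0 // => k /=.
  by apply/negbTE; rewrite neq_ltn -addnA ltn_addr ?orbT.
apply: eq_bigr => i _; rewrite lift_max.
rewrite (sum_ord_drop (h := ord_max)) => [|_]; last first.
  rewrite big_pred0 // => k /=.
  by apply/negbTE; rewrite neq_ltn -addnA addnC -addnA ltn_addr ?orbT.
apply: eq_bigr => j _; rewrite lift_max.
rewrite (sum_ord_drop (h := ord_max)) => [|/eqP /= nE]; last first.
  by move: nN; rewrite -nE ltnNge leq_addl.
by apply: eq_big => k; rewrite ?lift_max ?ffunE.
Qed.

(** K[t]-bilinearity of the extended bracket. Since multiplication by t raises
    the degree, only the truncations of the factors matter, and with them only
    the family of order N. *)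
Lemma mu_t_shiftl x y : mu_t nu_ (shift x) y = shift (mu_t mu_ x (trunc y)).
Proof.
apply/ffunP=> n; case: (unliftP ord0 n) => [m ->|->]; last first.
  by rewrite mu_t_ord0 !shift_ord0 linear0l.
have mN := ltn_ord m; rewrite shift_lift !ffunE lift0.
rewrite (sum_ord_drop (h := ord_max)) => [|_]; last first.
  rewrite (sum_ord_drop (h := ord0)) => [|_].
    rewrite big1 // => j _; rewrite big_pred0 // => k.
    by apply/negbTE; rewrite lift0 addnS addSn eqSS neq_ltn -addnA ltn_addr
       ?orbT.
  by rewrite big1 // => k _; rewrite shift_ord0 linear0l.
apply: eq_bigr => i _; rewrite lift_max.
rewrite (sum_ord_drop (h := ord0)) => [|_]; last first.
  by rewrite big1 // => k _; rewrite shift_ord0 linear0l.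
apply: eq_bigr => j _; rewrite lift0 shift_lift addnS.
rewrite (sum_ord_drop (h := ord_max)) => [|/eqP /= [mE]]; last first.
  by move: mN; rewrite -mE ltnNge leq_addl.
by apply: eq_big => k; rewrite ?lift_max ?ffunE // addSn.
Qed.

Lemma mu_t_shiftr x y : mu_t nu_ x (shift y) = shift (mu_t mu_ (trunc x) y).
Proof.
apply/ffunP=> n; case: (unliftP ord0 n) => [m ->|->]; last first.
  by rewrite mu_t_ord0 !shift_ord0 linear0r.
have mN := ltn_ord m; rewrite shift_lift !ffunE lift0.
have drop (i j : 'I_N.+2) :
    \sum_(k < N.+2 | (i + j + k == m.+1)%N) nu_ i (x j) (shift y k) =
    \sum_(k < N.+1 | (i + j + k == m)%N) nu_ i (x j) (y k).
  rewrite (sum_ord_drop (h := ord0)) => [|_]; last first.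
    by rewrite shift_ord0 linear0r.
  by apply: eq_big => k; rewrite ?lift0 ?addnS // shift_lift.
rewrite (sum_ord_drop (h := ord_max)) => [|_]; last first.
  rewrite big1 // => j _; rewrite drop big_pred0 // => k /=.
  by apply/negbTE; rewrite neq_ltn -addnA ltn_addr ?orbT.
apply: eq_bigr => i _.
rewrite (sum_ord_drop (h := ord_max)) => [|_]; last first.
  rewrite drop big_pred0 // => k /=.
  by apply/negbTE; rewrite neq_ltn -addnA addnC -addnA ltn_addr ?orbT.
apply: eq_bigr => j _; rewrite drop !lift_max.
by apply: eq_bigr => k _; rewrite ffunE nu_mu.
Qed.

(** In degree N + 1, only nu_0 and the constant term of x can meet t^(N+1) v. *)
Lemma mu_t_top_termr (x : S) v :
  mu_t nu_ x (top_term v) = top_term (nu_ ord0 (x ord0) v).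
Proof.
rewrite (additive_const_term (F := fun x => mu_t nu_ x (top_term v))); last first.
- by move=> y; rewrite mu_t_shiftl trunc_top_term linear0r shift0.
- by move=> y z; rewrite linearDl.
rewrite [LHS]trunc0_top_term; last first.
  by rewrite trunc_mu_t trunc_top_term linear0r.
congr top_term; rewrite mu_t_const_terml (sum_ord_single (h := ord0)) /=.
  by rewrite (big_pred1 ord_max) ?top_term_max // => j.
move=> i i0 _; rewrite big1 // => j /eqP ijN.
rewrite ffunE; case: eqP => [jN|_]; last by rewrite linear0r.
by case: i i0 ijN => [[|i] ?] //= _; rewrite jN /= => /eqP;
  rewrite -[X in _ == X]add0n eqn_add2r.
Qed.

Lemma mu_t_top_terml (x : S) v :
  mu_t nu_ (top_term v) x = top_term (nu_ ord0 v (x ord0)).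
Proof.
rewrite (additive_const_term (F := mu_t nu_ (top_term v))); last first.
- by move=> y; rewrite mu_t_shiftr trunc_top_term linear0l shift0.
- by move=> y z; rewrite linearDr.
rewrite [LHS]trunc0_top_term; last first.
  by rewrite trunc_mu_t trunc_top_term linear0l.
congr top_term; rewrite mu_t_const_termr (sum_ord_single (h := ord0)) /=.
  by rewrite (big_pred1 ord_max) ?top_term_max // => j.
move=> i i0 _; rewrite big1 // => j /eqP ijN.
rewrite ffunE; case: eqP => [jN|_]; last by rewrite linear0l.
by case: i i0 ijN => [[|i] ?] //= _; rewrite jN /= => /eqP;
  rewrite -[X in _ == X]add0n eqn_add2r.
Qed.

End Bilinear.

Section Linear.

Variable psi_ : 'I_N.+2 -> {linear g -> g}.

Lemma phi_t_ord0 (x : S) : phi_t psi_ x ord0 = psi_ ord0 (x ord0).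
Proof.
rewrite ffunE (sum_ord_single (h := ord0)) => [|i i0 _] /=; last first.
  rewrite big_pred0 // => k.
  by rewrite addn_eq0; case: i i0 => [[|i] ?].
by rewrite (sum_ord_single (h := ord0)) // => -[[|i] ?].
Qed.

Lemma phi_t_const_term v n : phi_t psi_ (const_term v) n = psi_ n v.
Proof.
rewrite ffunE (sum_ord_single (h := n)) /= => [|i inn _].
  rewrite (sum_ord_single (h := ord0)) /= => [|j j0 _].
    by rewrite addn0 eqxx ffunE.
  by rewrite ffunE (negbTE j0) linear0.
rewrite (sum_ord_single (h := ord0)) /= => [|j j0 _].
  by rewrite addn0 val_eqE (negbTE inn).
by rewrite ffunE (negbTE j0) linear0.
Qed.

Variable phi_ : 'I_N.+1 -> {linear g -> g}.
Hypothesis psi_phi : forall i x, psi_ (lift ord_max i) x = phi_ i x.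

Lemma trunc_phi_t x : trunc (phi_t psi_ x) = phi_t phi_ (trunc x).
Proof.
apply/ffunP=> n; have nN := ltn_ord n; rewrite !ffunE lift_max.
rewrite (sum_ord_drop (h := ord_max)) => [|_]; last first.
  rewrite big_pred0 // => k /=.
  by apply/negbTE; rewrite neq_ltn ltn_addr ?orbT.
apply: eq_bigr => i _; rewrite lift_max.
rewrite (sum_ord_drop (h := ord_max)) => [|/eqP /= nE]; last first.
  by move: nN; rewrite -nE ltnNge leq_addl.
by apply: eq_big => k; rewrite ?lift_max ?ffunE.
Qed.

Lemma phi_t_shift x : phi_t psi_ (shift x) = shift (phi_t phi_ x).
Proof.
apply/ffunP=> n; case: (unliftP ord0 n) => [m ->|->]; last first.
  by rewrite phi_t_ord0 !shift_ord0 linear0.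
have mN := ltn_ord m; rewrite shift_lift !ffunE lift0.
have drop (i : 'I_N.+2) :
    \sum_(k < N.+2 | (i + k == m.+1)%N) psi_ i (shift x k) =
    \sum_(k < N.+1 | (i + k == m)%N) psi_ i (x k).
  rewrite (sum_ord_drop (h := ord0)) => [|_]; last first.
    by rewrite shift_ord0 linear0.
  by apply: eq_big => k; rewrite ?lift0 ?addnS // shift_lift.
rewrite (sum_ord_drop (h := ord_max)) => [|_]; last first.
  rewrite drop big_pred0 // => k /=.
  by apply/negbTE; rewrite neq_ltn ltn_addr ?orbT.
apply: eq_bigr => i _; rewrite drop !lift_max.
by apply: eq_bigr => k _; rewrite psi_phi.
Qed.

Lemma phi_t_top_term v : phi_t psi_ (top_term v) = top_term (psi_ ord0 v).
Proof.
rewrite [LHS]trunc0_top_term; last first.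
  by rewrite trunc_phi_t trunc_top_term linear0.
congr top_term; rewrite ffunE (sum_ord_single (h := ord0)) /=.
  by rewrite (big_pred1 ord_max) ?top_term_max // => j.
move=> i i0 _; rewrite big1 // => j /eqP ijN.
rewrite ffunE; case: eqP => [jN|_]; last by rewrite linear0.
by case: i i0 ijN => [[|i] ?] //= _; rewrite jN /= => /eqP;
  rewrite -[X in _ == X]add0n eqn_add2r.
Qed.

End Linear.

End OneMoreOrder.

(** * The obstruction as the leading coefficient of the failure *)

Section Obstruction.

Variables (K : fieldType) (g : lmodType K) (N : nat).
Variables (mu_ : 'I_N.+1 -> {bilinear g -> g -> g}).
Variables (phi_ : 'I_N.+1 -> {linear g -> g}).

Definition zero_bilinear (x y : g) : g := 0.

Fact zero_bilinear_is_bilinear : bilinear_for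
  (GRing.Scale.Law.clone _ _ *:%R _) (GRing.Scale.Law.clone _ _ *:%R _)
  zero_bilinear.
Proof. by split=> u a x y; rewrite /zero_bilinear /= scaler0 addr0. Qed.

HB.instance Definition _ :=
  bilinear_isBilinear.Build K g g g _ _ zero_bilinear zero_bilinear_is_bilinear.

Definition zero_linear (x : g) : g := 0.

Fact zero_linear_is_linear : linear zero_linear.
Proof. by move=> a x y; rewrite /zero_linear scaler0 addr0. Qed.

HB.instance Definition _ :=
  GRing.isLinear.Build K g g _ zero_linear zero_linear_is_linear.

(** With any other choice in degree N + 1, the leading coefficients of J and E
    would differ from the obstruction by a coboundary. *)
Definition mu_ext (i : 'I_N.+2) : {bilinear g -> g -> g} :=
  if unlift ord_max i is Some k then mu_ k else zero_bilinear.

Definition phi_ext (i : 'I_N.+2) : {linear g -> g} :=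
  if unlift ord_max i is Some k then phi_ k else zero_linear.

Lemma mu_ext_lift i x y : mu_ext (lift ord_max i) x y = mu_ i x y.
Proof. by rewrite /mu_ext liftK. Qed.

Lemma mu_ext_max x y : mu_ext ord_max x y = 0.
Proof. by rewrite /mu_ext unlift_none. Qed.

Lemma mu_ext_ord0 x y : mu_ext ord0 x y = mu_ ord0 x y.
Proof. by rewrite -mu_ext_lift; congr (mu_ext _ x y); apply: val_inj. Qed.

Lemma phi_ext_lift i x : phi_ext (lift ord_max i) x = phi_ i x.
Proof. by rewrite /phi_ext liftK. Qed.

Lemma phi_ext_max x : phi_ext ord_max x = 0.
Proof. by rewrite /phi_ext unlift_none. Qed.

Lemma phi_ext_ord0 x : phi_ext ord0 x = phi_ ord0 x.
Proof. by rewrite -phi_ext_lift; congr (phi_ext _ x); apply: val_inj. Qed.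

Local Notation S := (tseries g N.+1).
Local Notation b := (mu_t mu_ext).
Local Notation d := (phi_t phi_ext).
Local Notation J := (bullet b b).
Local Notation E := (bracket_phi_mu d b).
Local Notation cst := (@const_term K g N).

Definition ob3 (u v w : g) : g := J (cst u) (cst v) (cst w) ord_max.
Definition ob2 (u v : g) : g := E (cst u) (cst v) ord_max.

(** The side conditions i, j > 0 hold automatically for i, j <= N with
    i + j = N + 1. *)
Lemma sum_top_degree (V : zmodType) (F : 'I_N.+2 -> 'I_N.+2 -> V) :
  (forall j, F ord_max j = 0) -> (forall i, F i ord_max = 0) ->
  \sum_(i < N.+2) \sum_(j < N.+2 | (i + j == N.+1)%N) F i j =
  \sum_(i < N.+1)
    \sum_(j < N.+1 | [&& (i + j == N.+1)%N, (0 < i)%N & (0 < j)%N])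
      F (lift ord_max i) (lift ord_max j).
Proof.
move=> Fl Fr; rewrite (sum_ord_drop (h := ord_max)) => [|_]; last first.
  by rewrite big1.
apply: eq_bigr => i _; rewrite (sum_ord_drop (h := ord_max)) //.
apply: eq_bigl => j; rewrite !lift_max.
have [ijN|//] := eqP; apply/esym/andP.
have := ltn_ord i; have := ltn_ord j; rewrite !ltnS.
case: (posnP i) ijN => [->|_]; first by rewrite add0n => ->; rewrite ltnn.
by case: (posnP j) => // -> ; rewrite addn0 => ->; rewrite ltnn.
Qed.

Lemma tseriesB (x y : S) n : (x - y) n = x n - y n.
Proof. by rewrite !ffunE. Qed.

Lemma tseriesD (x y : S) n : (x + y) n = x n + y n.
Proof. by rewrite !ffunE. Qed.

Lemma Ob3E (x : {ffun 'I_3 -> g}) :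
  [pchar K] =i pred0 -> Ob3 mu_ x = ob3 (x 0) (x 1) (x 2%:R).
Proof.
move=> charK0; rewrite /Ob3; move: (x 0) (x 1) (x 2%:R) => u v w.
have two : 2%:R != 0 :> K by have := charK0 2; rewrite !inE /= => /negbT.
pose T := \sum_(i < N.+1)
    \sum_(j < N.+1 | [&& (i + j == N.+1)%N, (0 < i)%N & (0 < j)%N])
      bullet (mu_ i) (mu_ j) u v w.
have TE : T = \sum_(i < N.+1)
    \sum_(j < N.+1 | [&& (i + j == N.+1)%N, (0 < i)%N & (0 < j)%N])
      bullet (mu_ j) (mu_ i) u v w.
  rewrite /T (exchange_big_dep xpredT) //=; apply: eq_bigr => i _.
  by apply: eq_bigl => j; rewrite addnC; congr (_ && _); rewrite andbC.
under eq_bigr do rewrite big_split.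
rewrite big_split /= -/T -TE.
rewrite -mulr2n -scaler_nat scalerA mulVf // scale1r.
rewrite /ob3 /bullet !tseriesB !mu_t_const_termr mu_t_const_terml.
rewrite /T -!sumrB.
transitivity (\sum_(i < N.+2) \sum_(j < N.+2 | (i + j == N.+1)%N)
    bullet (mu_ext i) (mu_ext j) u v w).
  rewrite sum_top_degree => [|j|i]; last 2 first.
  - by rewrite /bullet !mu_ext_max !subr0.
  - by rewrite /bullet !mu_ext_max !(linear0l, linear0r) !subr0.
  apply: eq_bigr => i _; apply: eq_bigr => j _.
  by rewrite /bullet !mu_ext_lift.
apply: eq_bigr => i _; rewrite -!sumrB; apply: eq_bigr => j _.
by rewrite !mu_t_const_term.
Qed.

Lemma Ob2E (x : {ffun 'I_2 -> g}) : Ob2 mu_ phi_ x = ob2 (x 0) (x 1).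
Proof.
rewrite /Ob2; move: (x 0) (x 1) => u v.
transitivity (\sum_(i < N.+2) \sum_(j < N.+2 | (i + j == N.+1)%N)
    bracket_phi_mu (phi_ext i) (mu_ext j) u v).
  rewrite sum_top_degree => [|j|i]; last 2 first.
  - by rewrite /bracket_phi_mu !phi_ext_max !(linear0l, linear0r) !subr0.
  - by rewrite /bracket_phi_mu !mu_ext_max linear0 !subr0.
  apply: eq_bigr => i _; apply: eq_bigr => j _.
  by rewrite /bracket_phi_mu !mu_ext_lift !phi_ext_lift.
rewrite /ob2 /bracket_phi_mu !tseriesB mu_t_const_termr mu_t_const_terml.
(* In E the product of mu_j and phi_i is expanded with the index of mu first. *)
have swap (F : 'I_N.+2 -> 'I_N.+2 -> g) :
    \sum_(i < N.+2) \sum_(j < N.+2 | (i + j == N.+1)%N) F i j =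
    \sum_(i < N.+2) \sum_(j < N.+2 | (i + j == N.+1)%N) F j i.
  rewrite (exchange_big_dep xpredT) //=; apply: eq_bigr => i _.
  by apply: eq_bigl => j; rewrite addnC.
rewrite [X in _ = _ - X - _]swap [X in _ = _ - _ - X]swap.
rewrite [X in _ = X - _ - _]ffunE.
rewrite -!sumrB; apply: eq_bigr => i _; rewrite -!sumrB; apply: eq_bigr => j _.
by rewrite mu_t_const_term !phi_t_const_term.
Qed.

Hypothesis leib : leibniz_identity (mu_t mu_).
Hypothesis der : derivation_of (mu_t mu_) (phi_t phi_).

Lemma bullet_leibniz (V : lmodType K) (c : V -> V -> V) x y z :
  leibniz_identity c -> bullet c c x y z = 0.
Proof. by move=> cL; rewrite /bullet (cL x y z) addrAC addrK subrr. Qed.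

Lemma linear_additive (U V : lmodType K) (F : U -> V) :
  linear F -> {morph F : x y / x + y}.
Proof. by move=> FL x y; rewrite -[x]scale1r FL !scale1r. Qed.

(** J is divisible by t^(N+1) since it vanishes after truncation, and kills
    multiples of t in each argument since there it is t times the jacobiator of
    the given deformation. *)
Lemma jacobiator_top_term (x y z : S) :
  J x y z = top_term N (ob3 (x ord0) (y ord0) (z ord0)).
Proof.
have nl := mu_ext_lift.
rewrite (additive_const_term (F := fun x => J x y z)); last 2 first.
- exact/linear_additive/bullet_linear1.
- move=> t; rewrite /bullet !(mu_t_shiftl nl) !(trunc_mu_t nl).
  by rewrite -!shiftB [X in shift X]bullet_leibniz ?shift0.
rewrite (additive_const_term (F := fun y => J _ y z)); last 2 first.
- exact/linear_additive/bullet_linear2.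
- move=> t; rewrite /bullet !(mu_t_shiftl nl, mu_t_shiftr nl) !(trunc_mu_t nl).
  by rewrite -!shiftB [X in shift X]bullet_leibniz ?shift0.
rewrite (additive_const_term (F := J _ _)); last 2 first.
- exact/linear_additive/bullet_linear3.
- move=> t; rewrite /bullet !(mu_t_shiftl nl, mu_t_shiftr nl) !(trunc_mu_t nl).
  by rewrite -!shiftB [X in shift X]bullet_leibniz ?shift0.
rewrite [LHS]trunc0_top_term //.
by rewrite /bullet !truncB !(trunc_mu_t nl) [LHS]bullet_leibniz.
Qed.

Lemma bracket_derivation (V : lmodType K) (c : V -> V -> V) (e : V -> V) x y :
  derivation_of c e -> bracket_phi_mu e c x y = 0.
Proof. by move=> ce; rewrite /bracket_phi_mu ce addrAC addrK subrr. Qed.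

Lemma defect_top_term (x y : S) : E x y = top_term N (ob2 (x ord0) (y ord0)).
Proof.
have nl := mu_ext_lift; have pl := phi_ext_lift.
have shE := (mu_t_shiftl nl, mu_t_shiftr nl, phi_t_shift pl).
have trE := (trunc_mu_t nl, trunc_phi_t pl).
rewrite (additive_const_term (F := fun x => E x y)); last 2 first.
- exact/linear_additive/bracket_phi_mu_linear1.
- move=> t; rewrite /bracket_phi_mu !shE !trE.
  by rewrite -!shiftB [X in shift X]bracket_derivation ?shift0.
rewrite (additive_const_term (F := E _)); last 2 first.
- exact/linear_additive/bracket_phi_mu_linear2.
- move=> t; rewrite /bracket_phi_mu !shE !trE.
  by rewrite -!shiftB [X in shift X]bracket_derivation ?shift0.
rewrite [LHS]trunc0_top_term //.
by rewrite /bracket_phi_mu !truncB !trE [LHS]bracket_derivation.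
Qed.

Lemma const_term_ord0 v : cst v ord0 = v.
Proof. by rewrite ffunE eqxx. Qed.

Lemma ob3_cocycle x y z w :
  let m := mu_ ord0 in
  m x (ob3 y z w) + m (ob3 x z w) y - m (ob3 x y w) z + m (ob3 x y z) w
  - ob3 (m x y) z w + ob3 (m x z) y w - ob3 (m x w) y z
  + ob3 x (m y z) w - ob3 x (m y w) z - ob3 x y (m z w) = 0.
Proof.
have nl := mu_ext_lift.
have := jacobiator_bianchi b (cst x) (cst y) (cst z) (cst w).
move=> /(congr1 (fun s : S => s ord_max)).
rewrite /= !jacobiator_top_term.
rewrite !(mu_t_top_termr nl, mu_t_top_terml nl) !mu_t_ord0.
rewrite !const_term_ord0 !mu_ext_ord0.
rewrite !(tseriesB, tseriesD) !top_term_max => ->; exact: ffunE.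
Qed.

Lemma ob2_cocycle x y z :
  let m := mu_ ord0 in let p := phi_ ord0 in
  p (ob3 x y z) - ob3 (p x) y z - ob3 x (p y) z - ob3 x y (p z)
  - bullet ob2 m x y z - bullet m ob2 x y z = 0.
Proof.
have nl := mu_ext_lift; have pl := phi_ext_lift.
have := jacobiator_defect b d (cst x) (cst y) (cst z).
move=> /(congr1 (fun s : S => s ord_max)).
rewrite /= !jacobiator_top_term /bullet !defect_top_term.
rewrite !(mu_t_top_termr nl, mu_t_top_terml nl, phi_t_top_term pl).
rewrite !(mu_t_ord0, phi_t_ord0) !const_term_ord0 !mu_ext_ord0 !phi_ext_ord0.
rewrite !tseriesB !top_term_max => ->; exact: ffunE.
Qed.

Lemma const_term_linear : linear cst.
Proof.
by move=> a u v; apply/ffunP=> n; rewrite !ffunE; case: eqP;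
  rewrite ?scaler0 ?addr0.
Qed.

Lemma coef_linear (n : 'I_N.+2) : linear (fun x : S => x n).
Proof. by move=> a x y; rewrite !ffunE. Qed.

Lemma ob3_linear1 y z : linear (fun x => ob3 x y z).
Proof.
move=> a u v; rewrite /ob3 const_term_linear.
by rewrite (bullet_linear1 b (cst y) (cst z)) coef_linear.
Qed.

Lemma ob3_linear2 x z : linear (fun y => ob3 x y z).
Proof.
move=> a u v; rewrite /ob3 const_term_linear.
by rewrite (bullet_linear2 b (cst x) (cst z)) coef_linear.
Qed.

Lemma ob3_linear3 x y : linear (ob3 x y).
Proof.
move=> a u v; rewrite /ob3 const_term_linear.
by rewrite (bullet_linear3 b (cst x) (cst y)) coef_linear.
Qed.

Lemma ob2_linear1 y : linear (fun x => ob2 x y).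
Proof.
move=> a u v; rewrite /ob2 const_term_linear.
by rewrite (bracket_phi_mu_linear1 b d (cst y)) coef_linear.
Qed.

Lemma ob2_linear2 x : linear (ob2 x).
Proof.
move=> a u v; rewrite /ob2 const_term_linear.
by rewrite (bracket_phi_mu_linear2 b d (cst x)) coef_linear.
Qed.

End Obstruction.

Theorem proposition5p10 (K : fieldType) (charK0 : [pchar K] =i pred0)
  (g : lmodType K) (mu : {bilinear g -> g -> g}) (phi : {linear g -> g})
  (pair_g : leibDer_pair mu phi) (N : nat)
  (mu_ : 'I_N.+1 -> {bilinear g -> g -> g}) (phi_ : 'I_N.+1 -> {linear g -> g})
  (deform : deformation mu phi mu_ phi_) :
  LeibDer_cocycle mu phi (Ob3 mu_, Ob2 mu_ phi_).
Proof.
have [mu0 phi0 leib der] := deform.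
have ob3E y := Ob3E mu_ y charK0.
split=> [|x|x].
- split.
    apply: (multilinear_ternary ob3E) => *.
    + exact: ob3_linear1.
    + exact: ob3_linear2.
    + exact: ob3_linear3.
  apply: (multilinear_binary (Ob2E mu_ phi_)) => *.
  + exact: ob2_linear1.
  + exact: ob2_linear2.
- rewrite [x]ffun_nth4 /LeibDer_diff /= (deltaL_ternary _ _ _ _ _ ob3E) -!mu0.
  exact: ob3_cocycle.
rewrite [x]ffun_nth3 /LeibDer_diff /=.
rewrite (deltaL_binary _ _ _ _ (Ob2E mu_ phi_)) (delta_ternary _ _ _ _ ob3E).
move: (x 0) (x 1) (x 2%:R) => u v w; rewrite -!mu0 -!phi0 -signr_odd scaleN1r.
(* Both sides have the same terms in different orders. *)
rewrite -[RHS](ob2_cocycle leib der u v w) /bullet.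
by apply: subr0_eq; zmod_cancel.
Qed.
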